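(* Let $\mathbf{y}=\mathbf{G}(x,\mathbf{y})$ be a well-conditioned system of $m$ equations. Suppose $(a,\mathbf{b})$ and $(c,\mathbf{d})$ are characteristic points of the system and $(a,\mathbf{b})\le(c,\mathbf{d})$. Then $(a,\mathbf{b})=(c,\mathbf{d})$. Thus the set of characteristic points of the system forms an antichain in $\mathbb{R}^{m+1}$ under the partial ordering $\le$.
   Context: Let $m\ge 1$ and $\mathbf{y}=(y_1,\dots,y_m)$. A system $\mathbf{y}=\mathbf{G}(x,\mathbf{y})$ means $y_i=G_i(x,y_1,\dots,y_m)$, $1\le i\le m$, where the $G_i$ are power series; its Jacobian matrix is $J_{\mathbf{G}}(x,\mathbf{y})=\big(\partial G_i/\partial y_j\big)_{1\le i,j\le m}$ (no derivative in $x$). The system is well-conditioned if: (a) each $G_i(x,\mathbf{y})$ is a power series with nonnegative real coefficients; (b) $\mathbf{G}$ is holomorphic in a neighborhood of the origin; (c) $\mathbf{G}(0,\mathbf{y})=\mathbf{0}$; (d) $G_i(x,\mathbf{0})\ne 0$ for all $i$; (e) the system is irreducible, i.e. the nonnegative matrix of power series $J_{\mathbf{G}}$ is irreducible (the directed graph on $\{1,\dots,m\}$ with an edge $i\to j$ whenever $\partial G_i/\partial y_j\neq 0$ is strongly connected); (f) $\partial^2 G_i/\partial y_j\partial y_k\ne 0$ for some $i,j,k$. A characteristic point of the system is a point $(a,\mathbf{b})\in\mathbb{R}^{m+1}$ with all coordinates positive that solves the characteristic system $\mathbf{y}=\mathbf{G}(x,\mathbf{y})$, $\det\big(I-J_{\mathbf{G}}(x,\mathbf{y})\big)=0$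 (in particular the series $G_i$ and $\partial G_i/\partial y_j$ converge at $(a,\mathbf{b})$). The ordering $\le$ on $\mathbb{R}^{m+1}$ is the componentwise ordering. *)

(* Defs.v *)
(* The complex numbers R[i] over R : realType come from real-closed. *)
From mathcomp Require Import all_boot all_order all_algebra.
From mathcomp Require Import all_classical all_reals all_analysis.
From mathcomp Require Import complex.

Set Implicit Arguments.
Unset Strict Implicit.
Unset Printing Implicit Defensive.

Import Order.TTheory GRing.Theory Num.Theory.
Import numFieldNormedType.Exports.

Local Open Scope classical_set_scope.
Local Open Scope ring_scope.

(* The exponent (p, q) stands for x ^ p * y_1 ^ q_1 * ... * y_m ^ q_m. *)
Definition expo (m : nat) : Type := (nat * {ffun 'I_m -> nat})%type.

(* Formal power series in x, y_1, ..., y_m, given by their coefficients. *)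
Definition power_series (R : realType) (m : nat) : Type := expo m -> R.

Definition monomial (K : comNzRingType) (m : nat) (k : expo m)
    (x : K) (y : 'rV[K]_m) : K :=
  x ^+ k.1 * \prod_(j < m) y 0 j ^+ k.2 j.

Definition partial_y (R : realType) (m : nat) (j : 'I_m) (g : power_series R m) :
    power_series R m :=
  fun k => (k.2 j).+1%:R * g (k.1, [ffun l => (k.2 l + (l == j))%N]).

(* \esum is a supremum of finite sums: this is the value of the series (+oo
   if it diverges) when all its terms are nonnegative, and it is only used for
   series with nonnegative coefficients at points with positive coordinates. *)
Definition value (R : realType) (m : nat) (g : power_series R m)
    (a : R) (b : 'rV[R]_m) : \bar R :=
  (\esum_(k in [set: expo m]) (g k * monomial k a b)%:E)%E.

(* A power series is holomorphic near the origin when it converges (absolutely)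
   on a neighborhood of the origin of C^(m+1); R[i]^o is the field R[i] with the
   topology given by its norm. *)
Definition holomorphic_near0 (R : realType) (m : nat) (g : power_series R m) : Prop :=
  \forall z \near ((0, 0) : R[i]^o * 'rV[R[i]^o]_m),
    (\esum_(k in [set: expo m])
       (ComplexField.Normc.normc
          ((g k)%:C%C * @monomial R[i] m k z.1 z.2))%:E < +oo)%E.

Definition Jacobian (R : realType) (m : nat) (G : 'I_m -> power_series R m) :
    'M[power_series R m]_m :=
  \matrix_(i, j) partial_y j (G i).

Definition irreducible_mx (R : realType) (m : nat) (A : 'M[power_series R m]_m) :
    Prop :=
  forall i j : 'I_m, connect (fun u v => `[< A u v <> (fun=> 0) >]) i j.

Record well_conditioned (R : realType) (m : nat) (G : 'I_m -> power_series R m) :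
    Prop := WellConditioned {
  wc_ge0 : forall i k, 0 <= G i k;
  wc_holomorphic : forall i, holomorphic_near0 (G i);
  (* G(0, y) = 0 *)
  wc_x0 : forall i, (fun q => G i (0%N, q)) = (fun=> 0);
  (* G_i(x, 0) <> 0 *)
  wc_y0 : forall i, (fun p => G i (p, [ffun=> 0%N])) <> (fun=> 0);
  wc_irreducible : irreducible_mx (Jacobian G);
  wc_nonlinear : exists i j k, partial_y j (partial_y k (G i)) <> (fun=> 0)
}.

Record characteristic_point (R : realType) (m : nat) (G : 'I_m -> power_series R m)
    (p : R * 'rV[R]_m) : Prop := CharacteristicPoint {
  cp_x_gt0 : 0 < p.1;
  cp_y_gt0 : forall i, 0 < p.2 0 i;
  cp_cvg : forall i, (value (G i) p.1 p.2 < +oo)%E;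
  cp_cvg_Jacobian : forall i j, (value (Jacobian G i j) p.1 p.2 < +oo)%E;
  cp_solution : forall i, p.2 0 i = fine (value (G i) p.1 p.2);
  cp_det :
    \det (1%:M - map_mx (fun g => fine (value g p.1 p.2)) (Jacobian G)) = 0
}.

(* The componentwise ordering of R^(m+1), seen as R * R^m. *)
Definition le_point (R : realType) (m : nat) (p q : R * 'rV[R]_m) : Prop :=
  p.1 <= q.1 /\ forall i, p.2 0 i <= q.2 0 i.

Definition antichain (T : Type) (le : T -> T -> Prop) (A : set T) : Prop :=
  forall p q, A p -> A q -> p <> q -> ~ le p q /\ ~ le q p.

(* Main.v *)
(* Let J be the Jacobian at the smaller point (a, b) and w := d - b >= 0. Since
   the coefficients are nonnegative, comparing the solutions through the tangent
   of G in y gives w >= J w, coordinate i being strict as soon as G_i has a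
   monomial lying strictly above its tangent. Since det (I - J) = 0, there is a
   nonzero u >= 0 with u <= u J, so that u w <= u J w <= u w, and w_i = (J w)_i
   wherever u_i > 0. If a < c, all coordinates are strict because G(x, 0) has no
   zero coordinate: a contradiction. If a = c and w <> 0, irreducibility makes w
   and u positive, and a nonlinear coordinate gives the contradiction. *)

Require Import Defs.
From mathcomp Require Import all_boot all_order all_algebra.
From mathcomp Require Import all_classical all_reals all_analysis.
From mathcomp Require Import ring lra.

Set Implicit Arguments.
Unset Strict Implicit.
Unset Printing Implicit Defensive.

Import Order.TTheory GRing.Theory Num.Theory.

Local Open Scope classical_set_scope.
Local Open Scope ring_scope.

(** * Scaling of sums, Bernoulli's inequality and exponents *)

Lemma esumZl (R : realType) (T : choiceType) (I : set T) (r : R)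
    (f : T -> \bar R) : 0 < r -> (forall i, I i -> 0 <= f i)%E ->
  (\esum_(i in I) (r%:E * f i) = r%:E * \esum_(i in I) f i)%E.
Proof.
have esumZl_le (s : R) (h : T -> \bar R) : 0 < s ->
    (forall i, I i -> 0 <= h i)%E ->
    (\esum_(i in I) (s%:E * h i) <= s%:E * \esum_(i in I) h i)%E.
  move=> s0 h0; apply: ge_ereal_sup => _ [X [finX XI]] <-.
  rewrite fsbig_finite//= big_seq_cond -ge0_sume_distrr; last first.
    by move=> i; rewrite andbT in_fset_set// inE => /XI/h0.
  rewrite lee_pmul2l// ?lte_fin// -big_seq_cond -fsbig_finite//.
  by apply: ereal_sup_ubound; exists X.
move=> r0 f0; apply/eqP; rewrite eq_le esumZl_le//=.
(* The reverse inequality is [esumZl_le] for the factor [r^-1]. *)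
rewrite -lee_pdivlMl//; apply: le_trans (esumZl_le r^-1 _ _ _); last 2 first.
- by rewrite invr_gt0.
- by move=> i /f0 fi0; rewrite mule_ge0// lee_fin ltW.
apply: le_esum => i _.
by rewrite muleA -EFinM mulVf ?gt_eqF// mul1e.
Qed.

(** Bernoulli's inequality bounds each factor, and $(1+x)(1+y)\ge 1+x+y$ for $x,y\ge 0$ combines
    them; the induction therefore also carries the nonnegativity of the sum. *)
Lemma prod_exp_ge1D (R : realFieldType) (n : nat) (q : 'I_n -> nat)
    (t : 'I_n -> R) : (forall j, 0 <= t j) ->
  1 + \sum_j (q j)%:R * t j <= \prod_j (1 + t j) ^+ q j.
Proof.
move=> t0.
have bernoulli (x : R) k : 0 <= x -> 1 + k%:R * x <= (1 + x) ^+ k.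
  move=> x0; elim: k => [|k IHk]; first by rewrite expr0 mul0r addr0.
  rewrite exprS; apply: le_trans (ler_wpM2l _ IHk); last by lra.
  have : 0 <= k%:R * x * x by rewrite !mulr_ge0.
  by rewrite -natr1; lra.
suff [] : 0 <= \sum_j (q j)%:R * t j /\
  1 + \sum_j (q j)%:R * t j <= \prod_j (1 + t j) ^+ q j by [].
elim/big_ind2 : _ => [|x1 x2 y1 y2 [x1_ge0 x12] [y1_ge0 y12]|j _].
- by rewrite addr0.
- split; first exact: addr_ge0.
  apply: le_trans (ler_pM _ _ x12 y12); try exact: addr_ge0.
  by have := mulr_ge0 x1_ge0 y1_ge0; lra.
- by rewrite mulr_ge0// bernoulli.
Qed.

(** Multiplication by $y_j$, on exponents: the coefficient of [partial_y j g] at [k] is a positive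
    multiple of [g (shift_expo j k)]. *)
Definition shift_expo (m : nat) (j : 'I_m) (k : expo m) : expo m :=
  (k.1, [ffun l => (k.2 l + (l == j))%N]).

Lemma shift_expo_inj (m : nat) (j : 'I_m) : injective (shift_expo j).
Proof.
move=> [p q] [p' q'] [-> /ffunP qq']; congr pair.
by apply/ffunP => l; have := qq' l; rewrite !ffunE => /addIn.
Qed.

(** * Monomials compared with their tangents *)

Section monomials.
Context {R : realType} {m : nat}.
Implicit Types (k : expo m) (a c : R) (b d : 'rV[R]_m).

Lemma monomial_gt0 k a b : 0 < a -> (forall j, 0 < b 0 j) ->
  0 < monomial k a b.
Proof.
by move=> a0 b0; rewrite mulr_gt0 ?exprn_gt0// prodr_gt0// => j _; rewrite exprn_gt0.
Qed.

Lemma prod_exp_addn (f : 'I_m -> R) (q : 'I_m -> nat) j :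
  \prod_l f l ^+ (q l + (l == j)) = f j * \prod_l f l ^+ q l.
Proof.
under eq_bigr do rewrite exprD.
rewrite big_split/= mulrC; congr (_ * _).
rewrite (bigD1 j)//= eqxx expr1 big1 ?mulr1// => l /negPf ->.
by rewrite expr0.
Qed.

Lemma monomial_shift k a b j :
  monomial (shift_expo j k) a b = b 0 j * monomial k a b.
Proof.
rewrite /monomial/=; under eq_bigr do rewrite ffunE.
by rewrite prod_exp_addn mulrCA.
Qed.

(* First-order Taylor polynomial at [b] of the monomial [k] in [y], at [d]. *)
Definition monomial_tangent k a b d : R :=
  monomial k a b * (1 + \sum_j (k.2 j)%:R * ((d 0 j - b 0 j) / b 0 j)).

(** In the relative increments $t_j=(d_j-b_j)/b_j$, the tangent inequality becomes Bernoulli's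
    inequality for products. *)
Lemma monomial_relative k a b d : (forall j, 0 < b 0 j) ->
  monomial k a d =
  monomial k a b * \prod_j (1 + (d 0 j - b 0 j) / b 0 j) ^+ k.2 j.
Proof.
move=> b0; rewrite /monomial -mulrA -big_split/=; congr (_ * _).
apply: eq_bigr => j _; rewrite -exprMn; congr (_ ^+ _).
by field; rewrite gt_eqF.
Qed.

Lemma relative_ge0 b d j : (forall j, 0 < b 0 j) ->
  (forall j, b 0 j <= d 0 j) -> 0 <= (d 0 j - b 0 j) / b 0 j.
Proof. by move=> b0 bd; rewrite divr_ge0 ?subr_ge0// ltW. Qed.

Lemma monomial_tangent_le k a c b d : 0 < a -> (forall j, 0 < b 0 j) ->
  a <= c -> (forall j, b 0 j <= d 0 j) ->
  monomial_tangent k a b d <= monomial k c d.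
Proof.
move=> a0 b0 ac bd; apply: (@le_trans _ _ (monomial k a d)).
  rewrite (@monomial_relative k a b d)// ler_pM2l ?monomial_gt0//.
  by apply: prod_exp_ge1D => j; exact: relative_ge0.
rewrite ler_wpM2r//.
  by apply: prodr_ge0 => j _; rewrite exprn_ge0// (le_trans (ltW (b0 j))).
by rewrite lerXn2r// nnegrE ltW// (lt_le_trans a0).
Qed.

Lemma monomial_tangent_lt_x k a c b d : 0 < a -> (forall j, 0 < b 0 j) ->
  a < c -> (forall j, b 0 j <= d 0 j) -> (0 < k.1)%N ->
  monomial_tangent k a b d < monomial k c d.
Proof.
move=> a0 b0 ac bd k0.
apply: (le_lt_trans (@monomial_tangent_le k a a b d a0 b0 (lexx _) bd)).
rewrite ltr_pM2r; first by rewrite ltrXn2r -?lt0n// ?ltW.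
by apply: prodr_gt0 => j _; rewrite exprn_gt0// (lt_le_trans (b0 j)).
Qed.

(** The monomial is divisible by $y_iy_j$ (possibly $i=j$), so its expansion contains the
    second-order term $t_it_j>0$, absent from the tangent. *)
Lemma monomial_tangent_lt_y k a b d i j : 0 < a -> (forall j, 0 < b 0 j) ->
  (forall j, b 0 j < d 0 j) ->
  monomial_tangent (shift_expo i (shift_expo j k)) a b d
    < monomial (shift_expo i (shift_expo j k)) a d.
Proof.
move=> a0 b0 bd; set k' := shift_expo _ _.
rewrite (@monomial_relative k' a b d)// ltr_pM2l ?monomial_gt0//.
pose t l := (d 0 l - b 0 l) / b 0 l.
have t0 l : 0 < t l by rewrite divr_gt0// subr_gt0.
have -> : \sum_l (k'.2 l)%:R * t l = \sum_l (k.2 l)%:R * t l + t j + t i.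
  under eq_bigr do rewrite !ffunE !natrD !mulrDl.
  have sumt h : \sum_l (l == h)%:R * t l = t h.
    rewrite (bigD1 h)//= eqxx mul1r big1 ?addr0// => l /negPf ->.
    by rewrite mul0r.
  by rewrite !big_split/= !sumt.
have -> : \prod_l (1 + t l) ^+ k'.2 l =
    (1 + t i) * ((1 + t j) * \prod_l (1 + t l) ^+ k.2 l).
  rewrite -!(prod_exp_addn (fun l => 1 + t l)).
  by apply: eq_bigr => l _; rewrite !ffunE.
have := @prod_exp_ge1D R m k.2 t (fun l => ltW (t0 l)).
set S := \sum_l _; set P := \prod_l _ => SP.
have S0 : 0 <= S by apply: sumr_ge0 => l _; rewrite mulr_ge0// ltW.
have tij : 0 < t i * t j by rewrite mulr_gt0.
have ti0 := t0 i; have tj0 := t0 j.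
have : (1 + t i) * ((1 + t j) * (1 + S)) <= (1 + t i) * ((1 + t j) * P).
  by rewrite !ler_wpM2l//; lra.
apply: lt_le_trans.
(* Expanding, $(1+t_i)(1+t_j)(1+S)$ exceeds $1+S+t_j+t_i$ by at least $t_it_j$. *)
have := mulr_ge0 (ltW ti0) S0; have := mulr_ge0 (ltW tj0) S0.
have := mulr_ge0 (ltW tij) S0; lra.
Qed.

End monomials.

(** * The tangent inequality for power series *)

Section tangent.
Context {R : realType} {m : nat}.
Implicit Types (g : power_series R m) (k : expo m) (a c : R) (b d : 'rV[R]_m).

(** The terms on the right are those of $y_j\,\partial g/\partial y_j$ divided by $b_j$. Reindexing
    along the injective [shift_expo j] makes the left side a subsum of them. *)
Lemma value_partial_y_le g a b j : (forall k, 0 <= g k) -> 0 < a ->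
  (forall l, 0 < b 0 l) ->
  (value (partial_y j g) a b <=
    \esum_(k in [set: expo m]) ((k.2 j)%:R * g k * monomial k a b / b 0 j)%:E)%E.
Proof.
move=> g0 a0 b0.
pose h (k : expo m) := ((k.2 j)%:R * g k * monomial k a b / b 0 j)%:E.
have h0 k : (0 <= h k)%E.
  rewrite lee_fin; apply: divr_ge0 (ltW (b0 j)).
  exact: mulr_ge0 (mulr_ge0 (ler0n _ _) (g0 k)) (ltW (monomial_gt0 k a0 b0)).
have -> : value (partial_y j g) a b =
    (\esum_(k in [set: expo m]) h (shift_expo j k))%E.
  apply: eq_esum => k _; rewrite /h monomial_shift /partial_y/= ffunE eqxx addn1.
  by congr (_%:E); rewrite -/(shift_expo j k); field; rewrite gt_eqF.
rewrite -(@esum_image _ _ _ [set: expo m] (shift_expo j) h); last first.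
  by move=> k k' _ _ /shift_expo_inj.
rewrite esum_mkcond; apply: le_esum => k _; case: ifP => // _; exact: h0.
Qed.

(** Each term at $(c,d)$ splits into its value at $(a,b)$, its linear part and its gap above the
    tangent. All three are nonnegative, so the sums separate even when infinite, and the sum of the
    gaps is at least the gap at [k0]. *)
Lemma value_tangent_le g a c b d k0 : (forall k, 0 <= g k) ->
  0 < a -> (forall j, 0 < b 0 j) -> a <= c -> (forall j, b 0 j <= d 0 j) ->
  (value g a b + \sum_j (d 0 j - b 0 j)%:E * value (partial_y j g) a b
    + (g k0 * (monomial k0 c d - monomial_tangent k0 a b d))%:E
    <= value g c d)%E.
Proof.
move=> g0 a0 b0 ac bd.
pose A k := (g k * monomial k a b)%:E.
pose B j (k : expo m) := ((k.2 j)%:R * g k * monomial k a b / b 0 j)%:E.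
pose C k := (g k * (monomial k c d - monomial_tangent k a b d))%:E.
have A0 k : (0 <= A k)%E by rewrite lee_fin mulr_ge0// ltW// monomial_gt0.
have B0 j k : (0 <= B j k)%E.
  rewrite lee_fin; apply: divr_ge0 (ltW (b0 j)).
  exact: mulr_ge0 (mulr_ge0 (ler0n _ _) (g0 k)) (ltW (monomial_gt0 k a0 b0)).
have w0 j : 0 <= d 0 j - b 0 j by rewrite subr_ge0.
have C0 k : (0 <= C k)%E.
  by rewrite lee_fin mulr_ge0// subr_ge0 monomial_tangent_le.
have wB0 k j : (0 <= (d 0 j - b 0 j)%:E * B j k)%E by rewrite mule_ge0// lee_fin.
have -> : value g c d = (\esum_(k in [set: expo m])
    (A k + \sum_j (d 0 j - b 0 j)%:E * B j k + C k))%E.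
  apply: eq_esum => k _; rewrite /A /B /C.
  under eq_bigr do rewrite -EFinM.
  rewrite sumEFin -!EFinD; congr (_%:E).
  have -> : \sum_j (d 0 j - b 0 j) * ((k.2 j)%:R * g k * monomial k a b / b 0 j)
      = g k * monomial k a b * \sum_j (k.2 j)%:R * ((d 0 j - b 0 j) / b 0 j).
    by rewrite mulr_sumr; apply: eq_bigr => j _; ring.
  by rewrite /monomial_tangent; ring.
rewrite esumD; [|by move=> k _; rewrite adde_ge0// sume_ge0|by []].
rewrite esumD; [|by []|by move=> k _; rewrite sume_ge0].
rewrite esum_sum//; apply: leeD; first apply: leeD => //.
(* A zero increment is treated apart, as [esumZl] wants a positive factor; the product is then 0
   even if the derivative is infinite. *)
- apply: lee_sum => j _; have := w0 j; rewrite le_eqVlt => /predU1P[<-|wj0].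
    by rewrite mul0e esum_ge0// => k _; rewrite mul0e.
  by rewrite esumZl// lee_pmul2l// value_partial_y_le.
- by apply: esum_ge; exists [set k0] => //; rewrite fsbig_set1.
Qed.

End tangent.

(** * Sub- and supersolutions of nonnegative matrices *)

Lemma connect_homo (T : finType) (e : rel T) (P : pred T) (x y : T) :
  (forall u v, e u v -> P u -> P v) -> connect e x y -> P x -> P y.
Proof.
move=> eP /connectP[p + ->]; elim: p x => //= z p IHp x /andP[xz zp] Px.
exact: IHp zp (eP _ _ xz Px).
Qed.

Section nonnegative_matrices.
Context {R : realType} {m : nat}.
Implicit Types (A : 'M[R]_m) (e : rel 'I_m) (u w : 'I_m -> R).

(* The absolute value of a left fixed vector of [A]; this replaces the
   Perron-Frobenius eigenvector, with [<=] in place of an eigenvalue [>= 1]. *)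
Lemma subinvariant_exists A : (forall i j, 0 <= A i j) -> \det (1%:M - A) = 0 ->
  exists u, [/\ forall i, 0 <= u i, exists i, 0 < u i &
    forall j, u j <= \sum_i u i * A i j].
Proof.
move=> A0 /eqP/det0P[v v0]; rewrite mulmxBr mulmx1 => /eqP.
rewrite subr_eq0 => /eqP vA; exists (fun i => `|v 0 i|); split => //.
  by move/rV0Pn : v0 => [i vi0]; exists i; rewrite normr_gt0.
move=> j; rewrite {1}vA mxE; apply: le_trans (ler_norm_sum _ _ _) _.
by apply: ler_sum => i _; rewrite normrM (ger0_norm (A0 i j)).
Qed.

Lemma sum_weighted_le A u w : (forall i, 0 <= w i) ->
  (forall j, u j <= \sum_i u i * A i j) ->
  \sum_i u i * w i <= \sum_i u i * \sum_j A i j * w j.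
Proof.
move=> w0 uA; under [leRHS]eq_bigr do rewrite mulr_sumr.
rewrite exchange_big/=; apply: ler_sum => j _.
under eq_bigr do rewrite mulrA.
by rewrite -mulr_suml ler_wpM2r.
Qed.

(** Strictness at [i0], weighted by $u_{i_0}>0$, would give $uAw<uw$, against [sum_weighted_le]. *)
Lemma supersolution_not_strict A u w i0 : (forall i, 0 <= w i) ->
  (forall i, 0 <= u i) -> (forall j, u j <= \sum_i u i * A i j) ->
  (forall i, \sum_j A i j * w j <= w i) ->
  0 < u i0 -> w i0 = \sum_j A i0 j * w j.
Proof.
move=> w0 u0 uA wA ui0; apply/eqP; rewrite eq_le wA andbT leNgt.
apply/negP => wi0; have := sum_weighted_le w0 uA.
rewrite leNgt => /negP; apply.
rewrite (bigD1 i0)//= [ltRHS](bigD1 i0)//= ltr_leD//.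
  by rewrite ltr_pM2l.
by apply: ler_sum => i _; rewrite ler_wpM2l.
Qed.

(** Since $w_k\ge A_{kl}w_l$, vanishing of $w$ travels forward along edges; a zero anywhere would
    reach [i0]. *)
Lemma supersolution_gt0 A e w i0 : (forall i j, connect e i j) ->
  (forall i j, 0 <= A i j) -> (forall i j, e i j -> 0 < A i j) ->
  (forall i, 0 <= w i) -> (forall i, \sum_j A i j * w j <= w i) ->
  0 < w i0 -> forall i, 0 < w i.
Proof.
move=> econn A0 eA w0 wA wi0 i; apply: contraTT wi0.
apply: (connect_homo (P := fun k => ~~ (0 < w k))) (econn i i0) => k l kl.
apply: contraNN => wl; apply: lt_le_trans (wA k).
rewrite (bigD1 l)//= ltr_pwDl ?mulr_gt0 ?eA// sumr_ge0// => j _.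
by rewrite mulr_ge0.
Qed.

(** Dual to [supersolution_not_strict]: a strict column $j$, weighted by $w_j>0$, would give
    $uw<uAw\le uw$. *)
Lemma subinvariant_eq A u w : (forall i, 0 < w i) -> (forall i, 0 <= u i) ->
  (forall j, u j <= \sum_i u i * A i j) ->
  (forall i, \sum_j A i j * w j <= w i) ->
  forall j, u j = \sum_i u i * A i j.
Proof.
move=> w0 u0 uA wA j; apply/eqP; rewrite eq_le uA/= leNgt; apply/negP => ltuj.
have : \sum_i u i * \sum_j A i j * w j <= \sum_i u i * w i.
  by apply: ler_sum => i _; rewrite ler_wpM2l.
rewrite leNgt => /negP; apply.
under [ltRHS]eq_bigr do rewrite mulr_sumr.
rewrite exchange_big/= (bigD1 j)//= [ltRHS](bigD1 j)//= ltr_leD//.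
  under eq_bigr do rewrite mulrA.
  by rewrite -mulr_suml ltr_pM2r.
apply: ler_sum => k _; under eq_bigr do rewrite mulrA.
by rewrite -mulr_suml ler_wpM2r// ltW.
Qed.

(** The inequality $u\le uA$ bounds $u$ only from above; once it is an equality, $u_l\ge u_kA_{kl}$
    carries positivity forward along edges. *)
Lemma subinvariant_gt0 A e u w : (forall i j, connect e i j) ->
  (forall i j, 0 <= A i j) -> (forall i j, e i j -> 0 < A i j) ->
  (forall i, 0 < w i) -> (forall i, 0 <= u i) ->
  (forall j, u j <= \sum_i u i * A i j) ->
  (forall i, \sum_j A i j * w j <= w i) ->
  (exists i, 0 < u i) -> forall i, 0 < u i.
Proof.
move=> econn A0 eA w0 u0 uA wA [i0 ui0] i.
apply: (connect_homo (P := fun k => 0 < u k)) (econn i0 i) ui0 => k l kl uk.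
rewrite (subinvariant_eq w0 u0 uA wA) (bigD1 k)//=.
rewrite ltr_pwDl ?mulr_gt0 ?eA// sumr_ge0// => j _.
by rewrite mulr_ge0.
Qed.

End nonnegative_matrices.

(** * The Jacobian and the tangent inequality at characteristic points *)

Lemma nonzero_coefficient (K : nmodType) (T : Type) (f : T -> K) :
  f <> (fun=> 0) -> exists k, f k != 0.
Proof.
move=> f0; apply: contrapT => /forallNP fk; apply: f0; apply: funext => k.
by have /negP/negPn/eqP := fk k.
Qed.

(** This is the matrix in [cp_det]; at a characteristic point of a system with nonnegative
    coefficients its entries are finite, so [fine] loses nothing. *)
Definition Jacobian_at (R : realType) (m : nat) (G : 'I_m -> power_series R m)
    (p : R * 'rV[R]_m) : 'M[R]_m :=
  map_mx (fun g => fine (value g p.1 p.2)) (Jacobian G).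

Section characteristic_points.
Context {R : realType} {m : nat}.
Variables (G : 'I_m -> power_series R m) (p : R * 'rV[R]_m).
Hypotheses (G_ge0 : forall i k, 0 <= G i k) (p_char : characteristic_point G p).

Lemma Jacobian_ge0 i j k : 0 <= Jacobian G i j k.
Proof. by rewrite mxE mulr_ge0. Qed.

Lemma Jacobian_term_ge0 i j k :
  (0 <= (Jacobian G i j k * monomial k p.1 p.2)%:E)%E.
Proof.
have [a0 b0 _ _ _ _] := p_char.
by rewrite lee_fin; exact: mulr_ge0 (Jacobian_ge0 _ _ _) (ltW (monomial_gt0 _ a0 b0)).
Qed.

Lemma Jacobian_at_ge0 i j : 0 <= Jacobian_at G p i j.
Proof.
by rewrite mxE fine_ge0// esum_ge0// => k _; exact: Jacobian_term_ge0.
Qed.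

Lemma Jacobian_at_gt0 i j :
  Jacobian G i j <> (fun=> 0) -> 0 < Jacobian_at G p i j.
Proof.
have [a0 b0 _ Jfin _ _] := p_char => /nonzero_coefficient[k Jk0].
rewrite mxE fine_gt0// Jfin andbT.
apply: (@lt_le_trans _ _ (Jacobian G i j k * monomial k p.1 p.2)%:E).
  by rewrite lte_fin mulr_gt0 ?monomial_gt0// lt_def Jk0 Jacobian_ge0.
by apply: esum_ge; exists [set k] => //; rewrite fsbig_set1.
Qed.

(** All values being finite, this is [value_tangent_le] rewritten with the two solution equations.
    The free exponent [k] lets any monomial witness strictness. *)
Lemma solution_tangent_le q i k : characteristic_point G q -> le_point p q ->
  \sum_j Jacobian_at G p i j * (q.2 0 j - p.2 0 j)
    + G i k * (monomial k q.1 q.2 - monomial_tangent k p.1 p.2 q.2)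
  <= q.2 0 i - p.2 0 i.
Proof.
have [a0 b0 Gfin Jfin Gsol _] := p_char.
move=> [c0 d0 Gfin' _ Gsol' _] [ac bd].
have value_fin (r : R * 'rV[R]_m) : 0 < r.1 -> (forall j, 0 < r.2 0 j) ->
    (value (G i) r.1 r.2 < +oo)%E -> r.2 0 i = fine (value (G i) r.1 r.2) ->
    value (G i) r.1 r.2 = (r.2 0 i)%:E.
  move=> x0 y0 fin ->; rewrite fineK// ge0_fin_numE//.
  apply: esum_ge0 => l _; rewrite lee_fin.
  exact: mulr_ge0 (G_ge0 _ _) (ltW (monomial_gt0 _ x0 y0)).
have J_fin j :
    value (partial_y j (G i)) p.1 p.2 = (Jacobian_at G p i j)%:E.
  rewrite mxE fineK; first by rewrite mxE.
  by rewrite ge0_fin_numE// esum_ge0// => l _; exact: Jacobian_term_ge0.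
have := value_tangent_le k (G_ge0 i) a0 b0 ac bd.
rewrite (value_fin p)// (value_fin q)//; under eq_bigr do rewrite J_fin -EFinM mulrC.
rewrite sumEFin -!EFinD lee_fin.
lra.
Qed.

End characteristic_points.

Theorem proposition11 (R : realType) (m : nat) (hm : (1 <= m)%N)
    (G : 'I_m -> power_series R m) (hG : well_conditioned G) :
  (forall (a c : R) (b d : 'rV[R]_m),
     characteristic_point G (a, b) -> characteristic_point G (c, d) ->
     le_point (a, b) (c, d) -> (a, b) = (c, d)) /\
  antichain (@le_point R m) [set p | characteristic_point G p].
Proof.
suff main (a c : R) (b d : 'rV[R]_m) :
    characteristic_point G (a, b) -> characteristic_point G (c, d) ->
    le_point (a, b) (c, d) -> (a, b) = (c, d).
  split=> // -[a b] [c d] ab cd neq; split=> le; apply: neq; first exact: main.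
  exact/esym/main.
move=> ab cd le; have [G0 _ Gx0 Gy0 irr [i [j [l Gijl]]]] := hG.
have [/= a0 b0 _ _ _ detJ] := ab.
have [/= ac bd] := le.
have tangent i' k := solution_tangent_le G0 ab i' k cd le.
pose A := Jacobian_at G (a, b); pose w i' := d 0 i' - b 0 i'.
have A0 : forall i' j', 0 <= A i' j' := Jacobian_at_ge0 G0 ab.
have w0 i' : 0 <= w i' by rewrite subr_ge0.
have [u [u0 ex_u uA]] := subinvariant_exists A0 detJ.
have wA i' : \sum_j' A i' j' * w j' <= w i'.
  (* Any exponent would do: the gap is nonnegative. *)
  apply: le_trans (tangent i' (0%N, [ffun=> 0%N])); rewrite lerDl mulr_ge0//.
  by rewrite subr_ge0 monomial_tangent_le.
(* Where $u_i>0$, $w_i=(Aw)_i$ leaves no room for a gap at a monomial that occurs in $G_i$. *)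
have tangent_eq i' k : 0 < u i' -> 0 < G i' k ->
    monomial k c d <= monomial_tangent k a b d.
  move=> ui Gk; have := tangent i' k => /=.
  rewrite -[leRHS]/(w i') (supersolution_not_strict w0 u0 uA wA ui).
  by rewrite gerDl pmulr_rle0// subr_le0.
have Gpos i' k : G i' k != 0 -> 0 < G i' k by move=> ?; rewrite lt_def G0 andbT.
have eq_ac : a = c.
  apply/eqP; rewrite eq_le ac leNgt; apply/negP => lt_ac.
  have [i0 ui0] := ex_u.
  have [p Gp] := nonzero_coefficient (Gy0 i0).
  have := tangent_eq _ _ ui0 (Gpos _ _ Gp).
  rewrite leNgt => /negP; apply; apply: monomial_tangent_lt_x => //=.
  (* The monomial $x^p$ found in $G_{i_0}(x,0)$ has $p>0$, because $G(0,y)=0$. *)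
  rewrite lt0n; apply: contraNneq Gp => ->.
  by have /(congr1 (@^~ [ffun=> 0%N]))-> := Gx0 i0.
rewrite -{}eq_ac in tangent_eq *; congr pair; apply/rowP => n.
apply/eqP; rewrite eq_le bd leNgt; apply/negP => lt_bd.
pose e x y := `[< Jacobian G x y <> (fun=> 0) >].
have eA x y : e x y -> 0 < A x y by move/asboolP; exact: Jacobian_at_gt0.
have wn0 : 0 < w n by rewrite subr_gt0.
have w_gt0 := supersolution_gt0 irr A0 eA w0 wA wn0.
have u_gt0 := subinvariant_gt0 irr A0 eA w_gt0 u0 uA wA ex_u.
(* A nonzero coefficient of the second derivative at [k] comes from the monomial of $G_i$ whose
   exponent is [k] shifted by [j] and [l], to which [monomial_tangent_lt_y] applies. *)
have [k Gk] := nonzero_coefficient Gijl.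
have := tangent_eq i (shift_expo l (shift_expo j k)) (u_gt0 i).
rewrite leNgt => /(_ _)/negP; apply.
  apply: Gpos; apply: contraNneq Gk => Gk0.
  by rewrite /partial_y/= -/(shift_expo j k) -/(shift_expo l (shift_expo j k)) Gk0 !mulr0.
by apply: monomial_tangent_lt_y => // x; rewrite -subr_gt0; exact: w_gt0.
Qed.
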